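(* For $n\geq 1$, $$f_n(321,2143,3142)=n!\left(1+\sum_{\substack{1\leq \ell\leq k\leq n\\ \ell+k\leq n}}\frac{1}{2^{\ell}}\binom{n-k-1}{\ell-1}\binom{k}{\ell}\right).$$
   Context: A forest on $[n]$ is an unordered rooted forest whose $n$ vertices are labeled bijectively by $[n]$. A forest avoids a pattern $\sigma$ if for every vertex $v$, the sequence of labels along the path from the root of the tree containing $v$ down to $v$ contains no subsequence in the same relative order as $\sigma$. $f_n(\sigma_1,\ldots,\sigma_m)$ is the number of forests on $[n]$ avoiding every $\sigma_i$. (These are the forests in which every root-to-vertex label sequence has at most one descent.) *)

(* Defs.v *)
From mathcomp Require Import all_boot all_order all_algebra.

Set Implicit Arguments.
Unset Strict Implicit.
Unset Printing Implicit Defensive.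

(* A rooted forest whose vertices are labeled bijectively by [n] is encoded by
   its parent function on 'I_n: [p v = None] means that v is a root, and
   [p v = Some u] that u is the parent of v.  The label i + 1 is represented
   by i : 'I_n; only the relative order of labels matters. *)
Definition parent_fun (n : nat) := {ffun 'I_n -> option 'I_n}.

Definition child_of (n : nat) (p : parent_fun n) : rel 'I_n :=
  fun v u => p v == Some u.

(* Since every vertex has at most one parent, requiring that each vertex
   has a root among its ancestors is the same as excluding cycles. *)
Definition is_forest (n : nat) (p : parent_fun n) : bool :=
  [forall v, exists r, (p r == None) && connect (child_of p) v r].

(* The argument m bounds the number of vertices listed. *)
Fixpoint root_path_rec (n : nat) (p : parent_fun n) (m : nat) (v : 'I_n) :
    seq 'I_n :=
  if m is m'.+1 then
    if p v is Some u then rcons (root_path_rec p m' u) v else [:: v]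
  else [::].

(* The vertices from the root down to v: in a forest on n vertices a root path
   has at most n of them, so the bound n never truncates it; see [root_pathP]. *)
Definition root_path (n : nat) (p : parent_fun n) (v : 'I_n) : seq 'I_n :=
  root_path_rec p n v.

Definition same_order (s t : seq nat) : bool :=
  (size s == size t) &&
  [forall i : 'I_(size s), forall j : 'I_(size s),
     (nth 0 s i < nth 0 s j) == (nth 0 t i < nth 0 t j)].

(* Masks enumerate the subsequences of s; see [contains_patternP]. *)
Definition contains_pattern (s sigma : seq nat) : bool :=
  [exists m : (size s).-tuple bool, same_order (mask m s) sigma].

Definition avoids (n : nat) (p : parent_fun n) (sigma : seq nat) : bool :=
  [forall v : 'I_n, ~~ contains_pattern (map val (root_path p v)) sigma].

Definition num_forests_avoiding (n : nat) (patterns : seq (seq nat)) : nat :=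
  #|[set p : parent_fun n | is_forest p && all (avoids p) patterns]|.

Lemma contains_patternP (s sigma : seq nat) :
  reflect (exists2 t, subseq t s & same_order t sigma)
          (contains_pattern s sigma).
Proof.
apply: (iffP existsP) => [[m ms]|[t /subseqP[m sz_m ->] ms]].
  by exists (mask m s) => //; apply: mask_subseq.
have szm : size m == size s by apply/eqP.
by exists (Tuple szm).
Qed.

Lemma root_path_rec_spec (n : nat) (p : parent_fun n) (c : seq 'I_n) v m :
  path (child_of p) v c -> p (last v c) = None -> size c < m ->
  root_path_rec p m v = rev (v :: c).
Proof.
elim: c v m => [|u c IHc] v [|m] //=.
  by move=> _ ->.
by move=> /andP[/eqP -> puc] pl szc; rewrite (IHc u m puc pl szc) [in RHS]rev_cons.
Qed.

Lemma root_pathP (n : nat) (p : parent_fun n) (v : 'I_n) : is_forest p ->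
  exists r s, [/\ root_path p v = r :: s, p r = None, last r s = v
                & path (fun u w => p w == Some u) r s].
Proof.
move=> /forallP/(_ v)/existsP[r /andP[/eqP pr /connectP[c0 pc0 r_c0]]].
have := r_c0; case/shortenP: pc0 => c pc uc _ r_c.
have szc : size c < n.
  by have := max_card [in v :: c]; rewrite (card_uniqP uc) card_ord.
have pl : p (last v c) = None by rewrite -r_c.
have e : root_path p v = rev (v :: c) by apply: root_path_rec_spec.
have rp := rev_path (fun u w => p w == Some u) v c.
exists r, (behead (rev (v :: c))); rewrite e lastI rev_rcons -r_c /=.
split=> //.
  case: c {pc uc szc pl e rp} r_c => [|u c] //= _.
  by rewrite rev_cons last_rcons.
by move: rp; rewrite -r_c => ->.
Qed.

(* Main.v *)
Require Import Defs.
From mathcomp Require Import all_boot all_order all_algebra.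
From mathcomp Require Import zify ring lra.
Set Implicit Arguments.
Unset Strict Implicit.
Unset Printing Implicit Defensive.
Import GRing.Theory.
Local Open Scope ring_scope.

(* Let K be the set of vertices v whose root path is increasing. In a forest
   whose root paths have at most one descent, a vertex of K is a root or has a
   smaller parent in K, while a vertex outside K has either a smaller parent
   outside K or a larger parent in K. Conversely, for fixed K, any independent
   choice of parents obeying these rules gives such a forest with increasing
   part K. So the count is the sum over K of the product of the numbers of
   choices. Reading K as a word from left to right, this product satisfies a
   recursion with two parameters: j, the number of vertices of K already read,
   and c, the number of vertices outside K already read. The sum over the K
   of size k, with r vertices outside, is (j + k)! (k + r)! / (j! k!) times the
   coefficient of t^r in (1 - t)^(-c) (1 + t / (2 (1 - t)))^k. *)

(** * Weighted counts of words and their generating function *)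

(** The letter [true] marks a vertex of K: its successor term is the choice of being a root. A
    vertex outside K is never a root. *)
Definition mask_weight_at (j c : nat) (s : seq bool) (i : nat) : nat :=
  if nth false s i then (j + count id (take i s)).+1
  else (c + count negb (take i s) + count id (drop i.+1 s))%N.

Definition mask_weight (j c : nat) (s : seq bool) : nat :=
  (\prod_(i < size s) mask_weight_at j c s i)%N.

Lemma mask_weight_cons_true j c s :
  mask_weight j c (true :: s) = (j.+1 * mask_weight j.+1 c s)%N.
Proof.
rewrite /mask_weight /= big_ord_recl /mask_weight_at /= addn0; congr (_ * _)%N.
by apply: eq_bigr => i _; rewrite /bump add1n /= !add0n; case: nth; rewrite ?addnS ?addSn.
Qed.

Lemma mask_weight_cons_false j c s :
  mask_weight j c (false :: s) = ((c + count id s) * mask_weight j c.+1 s)%N.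
Proof.
rewrite /mask_weight /= big_ord_recl /mask_weight_at /= addn0 drop0.
congr (_ * _)%N; apply: eq_bigr => i _ /=.
by rewrite /bump add1n /= !add0n; case: nth; rewrite ?addnS ?addSn.
Qed.

Lemma sum_tuple_cons (n : nat) (P : pred (seq bool)) (F : seq bool -> nat) :
  (\sum_(t : n.+1.-tuple bool | P t) F t =
   \sum_(t : n.-tuple bool | P (true :: t)) F (true :: t) +
   \sum_(t : n.-tuple bool | P (false :: t)) F (false :: t))%N.
Proof.
rewrite (reindex (fun x : bool * n.-tuple bool => cons_tuple x.1 x.2)) /=; last first.
  exists (fun t => (thead t, behead_tuple t)) => [[b t] _|t _] /=.
    by congr pair; apply: val_inj.
  by rewrite [RHS]tuple_eta; apply: val_inj.
transitivity (\sum_(b : bool) \sum_(t : n.-tuple bool | P (b :: t)) F (b :: t))%N.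
  by rewrite [RHS]pair_big_dep.
by rewrite big_bool.
Qed.

Definition weight_sum (n k j c : nat) : nat :=
  (\sum_(t : n.-tuple bool | count id t == k) mask_weight j c t)%N.

Lemma weight_sum0 k j c : weight_sum 0 k j c = (k == 0).
Proof.
rewrite /weight_sum; case: k => [|k].
  rewrite (big_pred1 [tuple]) => [|t]; last by rewrite (tuple0 t) /=; apply/esym/eqP.
  by rewrite /mask_weight big_ord0.
by rewrite big_pred0 // => t; rewrite tuple0.
Qed.

Lemma weight_sum_small n k j c : (n < k)%N -> weight_sum n k j c = 0%N.
Proof.
move=> ltnk; rewrite /weight_sum big_pred0 // => t.
by apply/eqP => tk; have := count_size id t; rewrite size_tuple tk leqNgt ltnk.
Qed.

Lemma weight_sumS0 n j c :
  weight_sum n.+1 0 j c = (c * weight_sum n 0 j c.+1)%N.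
Proof.
rewrite /weight_sum (sum_tuple_cons _ (fun s => count id s == 0%N)) /=.
rewrite big_pred0 // add0n big_distrr /=; apply: eq_bigr => t /eqP.
by rewrite add0n => t0; rewrite mask_weight_cons_false t0 addn0.
Qed.

Lemma weight_sumSS n k j c :
  weight_sum n.+1 k.+1 j c =
    (j.+1 * weight_sum n k j.+1 c + (c + k.+1) * weight_sum n k.+1 j c.+1)%N.
Proof.
rewrite /weight_sum (sum_tuple_cons _ (fun s => count id s == k.+1)) /=.
rewrite !big_distrr /=; congr (_ + _)%N; apply: eq_big => t //.
  by rewrite mask_weight_cons_true.
by move=> /eqP; rewrite add0n => tk; rewrite mask_weight_cons_false tk.
Qed.

(* The coefficient of t^r in (1 - t)^(-c) (1 + t / (2 (1 - t)))^k. *)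
Definition gcoef (k r c : nat) : rat :=
  \sum_(l < r.+1) (1 / 2%:R ^+ l) * ('C((r + c).-1, r - l))%:R * ('C(k, l))%:R.

Lemma gcoef_r0 k c : gcoef k 0 c = 1.
Proof. by rewrite /gcoef big_ord1 !bin0 expr0 divr1. Qed.

Lemma gcoef_k0 r c : gcoef 0 r c = ('C((r + c).-1, r))%:R.
Proof.
rewrite /gcoef big_ord_recl big1 => [|i _]; last by rewrite bin0n mulr0.
by rewrite subn0 bin0 expr0 divr1 mul1r mulr1 addr0.
Qed.

(** Expands one factor 1 + t / (2 (1 - t)): multiplying by t / (1 - t) lowers [r] and raises [c]. *)
Lemma gcoefSS k r c : gcoef k.+1 r.+1 c = gcoef k r.+1 c + gcoef k r c.+1 / 2%:R.
Proof.
rewrite /gcoef big_ord_recl [in RHS]big_ord_recl !bin0 -addrA; congr (_ + _).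
rewrite mulr_suml -big_split /=; apply: eq_bigr => i _.
rewrite /bump /= add1n binS natrD subSS addnS exprS.
by field; rewrite expf_neq0.
Qed.

(** Compares coefficients in the derivative of (1 - t)^(-c). *)
Lemma gcoef0_rec r c : r.+1%:R * gcoef 0 r.+1 c = c%:R * gcoef 0 r c.+1.
Proof.
rewrite !gcoef_k0 -!natrM; congr (_ %:R).
by rewrite addnS addSn /= mul_bin_left addKn.
Qed.

(* Compare coefficients in the derivative of (1 - t)^(-(k + c)) (t - t^2 / 2)^k,
   with k.+1 for k. *)
Lemma gcoef_rec k r c :
  (k.+1 + r.+1)%:R * gcoef k.+1 r.+1 c =
  (k.+1 + c)%:R * gcoef k.+1 r c.+1 + k.+1%:R * gcoef k r.+1 c.
Proof.
(* With [k1.-1] the identity also makes sense at [k1 = 0], where its factor is zero, so the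
   induction can start there. *)
suff gen k1 r1 c1 : (k1 + r1.+1)%:R * gcoef k1 r1.+1 c1 =
    (k1 + c1)%:R * gcoef k1 r1 c1.+1 + k1%:R * gcoef k1.-1 r1.+1 c1 by apply: gen.
elim: k1 r1 c1 => [|k1 IH] r1 c1; first by rewrite mul0r addr0 !add0n gcoef0_rec.
have Hk : k1%:R * gcoef k1 r1.+1 c1 =
   k1%:R * gcoef k1.-1 r1.+1 c1 + k1%:R * gcoef k1.-1 r1 c1.+1 / 2%:R.
  case: {IH} k1 => [|k1]; first by rewrite !mul0r add0r.
  by rewrite gcoefSS mulrDr mulrA.
have I1 := IH r1 c1.
case: r1 Hk I1 => [|r1] Hk I1.
  rewrite gcoefSS; move: Hk I1; rewrite !gcoef_r0 !natrD -[k1.+1%:R]natr1 /= => Hk I1; lra.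
(* Expanding by [gcoefSS], the goal is the linear combination [I1] + [I2] / 2 + [Hk]. *)
have I2 := IH r1 c1.+1.
rewrite !gcoefSS; move: Hk I1 I2; rewrite !natrD.
rewrite -[k1.+1%:R]natr1 -[r1.+2%:R]natr1 -[r1.+1%:R]natr1 /= => Hk I1 I2; lra.
Qed.

(** Induction on the length of the word, splitting off its first letter. This reduces the claim to
    [gcoef_rec], or to [gcoef0_rec] when [k = 0]. The denominators are cleared to avoid division. *)
Lemma weight_sumE k r j c :
  (weight_sum (k + r) k j c)%:R * j`!%:R * k`!%:R =
  (j + k)`!%:R * (k + r)`!%:R * gcoef k r c.
Proof.
move En : (k + r)%N => n.
elim: n k r j c En => [|n IH] [|k] [|r] j c En; rewrite ?addn0 ?add0n in En *; try lia.
- by rewrite weight_sum0 gcoef_r0 fact0 eqxx !mulr1 mul1r.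
- have E := IH 0%N r j c.+1 ltac:(lia).
  case: En => En; rewrite weight_sumS0 -En factS !natrM.
  move: E; rewrite addn0 -En fact0 !mulr1 => E.
  transitivity (c%:R * ((weight_sum r 0 j c.+1)%:R * j`!%:R) : rat); first ring.
  by rewrite E; transitivity (j`!%:R * r`!%:R * (c%:R * gcoef 0 r c.+1) : rat);
    [ring|rewrite -gcoef0_rec; ring].
- case: En => En; subst n; have E := IH k 0%N j.+1 c (addn0 k).
  (* With no vertex outside K the first letter cannot be [false], so that branch vanishes. *)
  rewrite weight_sumSS (@weight_sum_small _ k.+1) // muln0 addn0 natrM.
  transitivity (k.+1%:R * ((weight_sum k k j.+1 c)%:R * j.+1`!%:R * k`!%:R) : rat).
    by rewrite !factS !natrM; ring.
  by rewrite E addSnnS !gcoef_r0 (factS k) natrM; ring.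
- have E1 := IH k r.+1 j.+1 c ltac:(lia).
  have E2 := IH k.+1 r j c.+1 ltac:(lia).
  have G := gcoef_rec k r c.
  case: En => En.
  rewrite weight_sumSS natrD (natrM _ j.+1) (natrM _ (c + k.+1)).
  transitivity (k.+1%:R * ((weight_sum n k j.+1 c)%:R * j.+1`!%:R * k`!%:R) +
      (c + k.+1)%:R * ((weight_sum n k.+1 j c.+1)%:R * j`!%:R * k.+1`!%:R) : rat).
    by rewrite !factS !natrM; ring.
  rewrite E1 E2 addSnnS (factS n) natrM.
  transitivity ((j + k.+1)`!%:R * n`!%:R *
      ((k.+1 + c)%:R * gcoef k.+1 r c.+1 + k.+1%:R * gcoef k r.+1 c) : rat).
    by rewrite [(c + _)%N]addnC; ring.
  by rewrite -G -En addSn; ring.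
Qed.

Local Close Scope ring_scope.

(** * Descents and the three patterns in sequences *)

Lemma same_order_321 (a b c : nat) : c < b -> b < a ->
  same_order [:: a; b; c] [:: 3; 2; 1].
Proof.
move=> cb ba; rewrite /same_order /=.
by apply/forallP => -[[|[|[|//]]] ?]; apply/forallP => -[[|[|[|//]]] ?] /=; lia.
Qed.

Lemma same_order_2143 (a b c d : nat) : b < a -> a < d -> d < c ->
  same_order [:: a; b; c; d] [:: 2; 1; 4; 3].
Proof.
move=> ba ad dc; rewrite /same_order /=.
by apply/forallP => -[[|[|[|[|//]]]] ?]; apply/forallP => -[[|[|[|[|//]]]] ?] /=; lia.
Qed.

Lemma same_order_3142 (a b c d : nat) : b < d -> d < a -> a < c ->
  same_order [:: a; b; c; d] [:: 3; 1; 4; 2].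
Proof.
move=> bd da ac; rewrite /same_order /=.
by apply/forallP => -[[|[|[|[|//]]]] ?]; apply/forallP => -[[|[|[|[|//]]]] ?] /=; lia.
Qed.

Definition one_descent_patterns : seq (seq nat) :=
  [:: [:: 3; 2; 1]; [:: 2; 1; 4; 3]; [:: 3; 1; 4; 2]].

(** The descents are a, b and c, d, possibly sharing b = c. If d < b, then a, b, d is a 321.
    Otherwise the four entries are distinct, and the place of a relative to d < c decides: above c
    gives 321, between them 3142, below d 2143. *)
Lemma contains_two_descents (s : seq nat) (a b c d : nat) :
  uniq s -> b < a -> d < c -> subseq [:: a; b; d] s ->
  b = c \/ subseq [:: a; b; c; d] s ->
  exists2 sigma, sigma \in one_descent_patterns & contains_pattern s sigma.
Proof.
move=> us ba dc sabd sabcd.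
have ne_bd : b != d.
  by have := subseq_uniq sabd us; rewrite /= !inE; lia.
have [db|bd] := ltnP d b.
  exists [:: 3; 2; 1]; rewrite ?inE //; apply/contains_patternP.
  by exists [:: a; b; d]; rewrite ?same_order_321.
case: sabcd => [bc|sabcd]; first by lia.
have := subseq_uniq sabcd us; rewrite /= !inE => nabcd.
have [ca|ac] := ltnP c a.
  exists [:: 3; 2; 1]; rewrite ?inE //; apply/contains_patternP.
  exists [:: a; c; d]; rewrite ?same_order_321 //.
  by apply: subseq_trans (cat_subseq (subseq_refl [:: a]) (subseq_cons [:: c; d] b)) sabcd.
have [da|ad] := ltnP d a.
  exists [:: 3; 1; 4; 2]; rewrite ?inE //; apply/contains_patternP.
  by exists [:: a; b; c; d]; rewrite ?same_order_3142 //; lia.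
exists [:: 2; 1; 4; 3]; rewrite ?inE //; apply/contains_patternP.
by exists [:: a; b; c; d]; rewrite ?same_order_2143 //; lia.
Qed.

Lemma subseq_cat_split (T : eqType) (t s1 s2 : seq T) :
  subseq t (s1 ++ s2) -> exists t1 t2, [/\ t = t1 ++ t2, subseq t1 s1 & subseq t2 s2].
Proof.
case/subseqP => m szm ->; rewrite size_cat in szm.
exists (mask (take (size s1) m) s1), (mask (drop (size s1) m) s2).
split; rewrite ?mask_subseq // -mask_cat ?cat_take_drop //.
by rewrite size_takel // szm leq_addr.
Qed.

(** An occurrence is cut into two increasing pieces, so it has at most one descent, while each
    pattern has two. *)
Lemma two_sorted_avoids (s1 s2 : seq nat) (sigma : seq nat) :
  sorted ltn s1 -> sorted ltn s2 -> sigma \in one_descent_patterns ->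
  ~~ contains_pattern (s1 ++ s2) sigma.
Proof.
move=> ss1 ss2 sigmaP; apply/contains_patternP => -[t].
case/subseq_cat_split => t1 [t2 [-> sub1 sub2]].
have := subseq_sorted ltn_trans sub2 ss2.
have := subseq_sorted ltn_trans sub1 ss1.
move=> {sub1 sub2 ss1 ss2} st1 st2 /andP[/eqP sz /forallP so].
have so' i j : i < size (t1 ++ t2) -> j < size (t1 ++ t2) ->
    (nth 0 (t1 ++ t2) i < nth 0 (t1 ++ t2) j) = (nth 0 sigma i < nth 0 sigma j).
  by move=> hi hj; have /forallP/(_ (Ordinal hj))/eqP := so (Ordinal hi).
move: {so} so' sz st1 st2; move: sigmaP; rewrite !inE => /or3P[]/eqP->.
- move=> so sz; have := so 0 1; have := so 1 2; rewrite sz /=.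
  case: t1 sz {so} => [|a [|b [|c [|? ?]]]]; case: t2 => [|d [|e [|f [|? ?]]]] //=; lia.
- move=> so sz; have := so 0 1; have := so 2 3; rewrite sz /=.
  case: t1 sz {so} => [|a [|b [|c [|x [|? ?]]]]];
  case: t2 => [|d [|e [|f [|y [|? ?]]]]] //=; lia.
- move=> so sz; have := so 0 1; have := so 2 3; rewrite sz /=.
  case: t1 sz {so} => [|a [|b [|c [|x [|? ?]]]]];
  case: t2 => [|d [|e [|f [|y [|? ?]]]]] //=; lia.
Qed.

Lemma exists_descent (s : seq nat) : uniq s -> ~~ sorted ltn s ->
  exists s1 s2 x y, s = s1 ++ x :: y :: s2 /\ y < x.
Proof.
elim: s => [|a [|b s] IHs] // /andP[nas us]; rewrite [sorted _ _]/= negb_and.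
have [ab /= nps|ba _] := boolP (a < b).
  have [s1 [s2 [x [y [-> lt_yx]]]]] := IHs us nps.
  by exists (a :: s1), s2, x, y.
by exists [::], s, a, b; split=> //; move: nas; rewrite inE; lia.
Qed.

(** * Root paths in a forest *)

Section Forest.

Variables (n : nat) (p : parent_fun n).
Hypothesis forest_p : is_forest p.

(** A chain of parents without repetition has at most [n] vertices, so the bound in [root_path] does
    not truncate it. *)
Lemma root_path_chain v : exists c,
  [/\ path (child_of p) v c, p (last v c) = None, uniq (v :: c), size c < n
    & root_path p v = rev (v :: c)].
Proof.
have /forallP/(_ v)/existsP[r /andP[/eqP pr /connectP[c0 pc0 r_c0]]] := forest_p.
have := r_c0; case/shortenP: pc0 => c pc uc _ r_c.
have szc : size c < n.
  by have := max_card [in v :: c]; rewrite (card_uniqP uc) card_ord.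
have pl : p (last v c) = None by rewrite -r_c.
by exists c; split=> //; apply: root_path_rec_spec.
Qed.

Lemma root_path_None v : p v = None -> root_path p v = [:: v].
Proof.
move=> pv; have [[|u c] [pc _ _ _ ->]] // := root_path_chain v.
by move: pc; rewrite /= /child_of pv.
Qed.

Lemma root_path_Some v u : p v = Some u -> root_path p v = rcons (root_path p u) v.
Proof.
move=> pv; have [[|w c] [pc pl uc szc ->]] := root_path_chain v.
  by rewrite /= pv in pl.
move: pc pl; rewrite /= /child_of pv => /andP[/eqP[<-] pc] pl.
rewrite rev_cons; congr rcons.
by rewrite /root_path (root_path_rec_spec pc pl) // ltnW.
Qed.

Lemma root_path_uniq v : uniq (root_path p v).
Proof. by have [c [_ _ uc _ ->]] := root_path_chain v; rewrite rev_uniq. Qed.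

Lemma root_path_last v : exists s, root_path p v = rcons s v.
Proof.
case pv : (p v) => [u|]; first by exists (root_path p u); apply: root_path_Some.
by exists [::]; apply: root_path_None.
Qed.

End Forest.

(** * Forests with a prescribed increasing part K *)

Definition path_labels n (p : parent_fun n) (v : 'I_n) : seq nat :=
  map val (root_path p v).

Definition increasing_vertices n (p : parent_fun n) : n.-tuple bool :=
  [tuple sorted ltn (path_labels p v) | v < n].

(** An edge between K and its complement must have its parent in K: a root path that has left K
    never returns. *)
Definition parent_choices n (K : n.-tuple bool) (v : 'I_n) : pred (option 'I_n) :=
  fun o => if o is Some u then
             if tnth K u == tnth K v then u < v else tnth K u && (v < u)
           else tnth K v.

Lemma sorted_rcons2 (s : seq nat) u v :
  sorted ltn (rcons (rcons s u) v) = sorted ltn (rcons s u) && (u < v).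
Proof. by case: s => [|a s] /=; rewrite ?andbT // rcons_path last_rcons. Qed.

Lemma good_forest_choices n (p : parent_fun n) :
  is_forest p -> all (avoids p) one_descent_patterns ->
  p \in family (parent_choices (increasing_vertices p)).
Proof.
move=> fp av; apply/familyP => v; rewrite unfold_in /parent_choices.
case pv: (p v) => [u|]; rewrite !tnth_mktuple; last first.
  by rewrite /path_labels (root_path_None fp).
have [s Eu] := root_path_last fp u.
have Ev := root_path_Some fp pv.
have uv : uniq (path_labels p v).
  by rewrite map_inj_uniq ?(root_path_uniq fp) //; apply: val_inj.
have uu : uniq (path_labels p u).
  by rewrite map_inj_uniq ?(root_path_uniq fp) //; apply: val_inj.
have Lu : path_labels p u = rcons (map val s) u by rewrite /path_labels Eu map_rcons.
have Lv : path_labels p v = rcons (path_labels p u) v by rewrite /path_labels Ev map_rcons.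
have neuv : (u : nat) != v.
  by move: uv; rewrite Lv Lu !rcons_uniq mem_rcons inE; lia.
have -> : sorted ltn (path_labels p v) = sorted ltn (path_labels p u) && (u < v).
  by rewrite Lv Lu sorted_rcons2.
have [su|nsu] := boolP (sorted ltn (path_labels p u)) => /=; first by case: ltngtP neuv.
have [//|leuv] := ltnP u v.
have ltvu : v < u by lia.
(* The path to [u] already has a descent [x], [y]. Since [v < u], the path to [v] would have a
   second one. *)
have [s1 [s2 [x [y [Eq ltyx]]]]] := exists_descent uu nsu.
suff [sigma sin]: exists2 sigma, sigma \in one_descent_patterns &
    contains_pattern (path_labels p v) sigma.
  move/(@allP (seq nat))/(_ _ sin)/forallP/(_ v): av.
  by rewrite /path_labels => /negbTE->.
apply: (@contains_two_descents _ x y u v) => //.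
  rewrite Lv Eq -cats1 -catA; apply: subseq_trans (suffix_subseq _ _).
  by rewrite /= !eqxx sub1seq mem_cat mem_head orbT.
(* Either the first descent ends at [u], and the two share [y = u], or [u] comes later on the
   path. *)
case/lastP: s2 Eq => [|s2 z] Eq.
  left; move: Eq; rewrite Lu -cats1 -[[:: x; y]]/(rcons [:: x] y) -rcons_cat cats1.
  by move=> /rcons_inj[].
right; have zu : z = u.
  by move: Eq; rewrite Lu -!rcons_cons -rcons_cat => /rcons_inj[].
rewrite Lv Eq zu -!cats1 -catA; apply: subseq_trans (suffix_subseq _ _).
rewrite /= !eqxx -catA; apply: subseq_trans (suffix_subseq _ _).
by rewrite /= !eqxx.
Qed.

Section Choices.

Variables (n : nat) (K : n.-tuple bool) (p : parent_fun n).
Hypothesis pK : p \in family (parent_choices K).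

(* Following parents, labels decrease outside K until K is entered, and then
   decrease again inside K, so the induction is well founded. *)
Lemma choices_ind (P : 'I_n -> Prop) :
  (forall v, p v = None -> tnth K v -> P v) ->
  (forall v u, p v = Some u -> tnth K v -> tnth K u -> u < v -> P u -> P v) ->
  (forall v u, p v = Some u -> ~~ tnth K v -> ~~ tnth K u -> u < v -> P u -> P v) ->
  (forall v u, p v = Some u -> ~~ tnth K v -> tnth K u -> v < u -> P u -> P v) ->
  forall v, P v.
Proof.
move=> h0 h1 h2 h3.
have pKv v : parent_choices K v (p v) by have /familyP/(_ v) := pK.
have PK v : tnth K v -> P v.
  elim/ltn_ind: {v}(val v) {-2}v (erefl (val v)) => m IH v Em Kv.
  move: (pKv v); rewrite /parent_choices Kv.
  case pv: (p v) => [u|] => [|_]; last exact: h0.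
  case Ku: (tnth K u) => //= ltuv.
  by apply: (h1 _ _ pv) => //; apply: (IH u) => //; rewrite -Em.
move=> v; have [/PK//|] := boolP (tnth K v).
elim/ltn_ind: {v}(val v) {-2}v (erefl (val v)) => m IH v Em nKv.
move: (pKv v); rewrite /parent_choices (negbTE nKv).
case pv: (p v) => [u|//].
have [Ku /= ltvu|nKu /= ltuv] := boolP (tnth K u); first exact: (h3 _ _ pv) (PK u Ku).
by apply: (h2 _ _ pv) => //; apply: (IH u) => //; rewrite -Em.
Qed.

Lemma choices_forest : is_forest p.
Proof.
apply/forallP; elim/choices_ind => [v pv _|v u pv _ _ _|v u pv _ _ _|v u pv _ _ _].
1: by apply/existsP; exists v; rewrite pv eqxx connect0.
all: case/existsP => r /andP[pr cur]; apply/existsP; exists r; rewrite pr /=.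
all: by apply: connect_trans cur; apply: connect1; rewrite /child_of pv.
Qed.

Lemma path_labels_step v u : p v = Some u ->
  exists s : seq nat, path_labels p u = rcons s u /\ path_labels p v = rcons (rcons s u) v.
Proof.
move=> pv; have [s Eu] := root_path_last choices_forest u.
exists (map val s); rewrite /path_labels (root_path_Some choices_forest pv) Eu.
by rewrite !map_rcons.
Qed.

(** Recovers [K] from [p], so the families for different [K] are disjoint. *)
Lemma choices_increasing v : sorted ltn (path_labels p v) = tnth K v.
Proof.
elim/choices_ind: v => [v pv ->|v u pv -> Ku uv|v u pv nKv nKu _|v u pv nKv _ vu].
- by rewrite /path_labels (root_path_None choices_forest pv).
- by have [s [-> ->]] := path_labels_step pv; rewrite sorted_rcons2 Ku uv => ->.
- have [s [-> ->]] := path_labels_step pv.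
  by rewrite sorted_rcons2 (negbTE nKv) (negbTE nKu) => ->.
- have [s [_ ->]] := path_labels_step pv.
  by rewrite sorted_rcons2 (negbTE nKv) [u < v]ltnNge (ltnW vu) andbF.
Qed.

(** The cut falls where the path leaves [K]; for [v] in [K] the first piece is empty. *)
Lemma choices_two_sorted v :
  exists s1 s2 : seq nat, [/\ path_labels p v = s1 ++ rcons s2 v,
                    sorted ltn s1 & sorted ltn (rcons s2 v)].
Proof.
have inK u : tnth K u -> exists s : seq nat, path_labels p u = rcons s u /\ sorted ltn (rcons s u).
  rewrite -choices_increasing; have [s] := root_path_last choices_forest u.
  by rewrite /path_labels => ->; rewrite map_rcons; exists (map val s).
elim/choices_ind: v => [v _|v u _|v u pv _ _ uv|v u pv _ Ku vu].
- by case/inK => s [-> ss]; exists [::], s.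
- by case/inK => s [-> ss]; exists [::], s.
- have [s [-> ->]] := path_labels_step pv => -[s1 [s2 [-> ss1 ss2]]].
  by exists s1, (rcons s2 u); rewrite rcons_cat sorted_rcons2 ss2 uv.
- have [s [Eu ->]] := path_labels_step pv => _.
  exists (rcons s u), [::]; rewrite cats1; split=> //.
  by rewrite -Eu choices_increasing.
Qed.

Lemma choices_avoid : all (avoids p) one_descent_patterns.
Proof.
apply/(@allP (seq nat)) => sigma sin; apply/forallP => v; rewrite -/(path_labels p v).
have [s1 [s2 [-> ss1 ss2]]] := choices_two_sorted v.
exact: two_sorted_avoids.
Qed.

End Choices.

(** The forests are classified by their increasing part; for fixed [K] they form a family of
    independent choices. *)
Lemma num_forests_sum n :
  num_forests_avoiding n one_descent_patterns =
  \sum_(K : n.-tuple bool) \prod_(v < n) #|parent_choices K v|.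
Proof.
rewrite /num_forests_avoiding -sum1_card.
rewrite (partition_big (@increasing_vertices n) predT) //=.
apply: eq_bigr => K _.
transitivity #|family (parent_choices K)|; last first.
  by rewrite card_family foldrE big_map big_enum.
rewrite -sum1_card; apply: eq_bigl => p; rewrite inE.
apply/idP/idP => [/andP[/andP[fp av] /eqP <-]|pK]; first exact: good_forest_choices.
apply/andP; split; first by rewrite (choices_forest pK); apply: (choices_avoid pK).
apply/eqP/eq_from_tnth => v.
by rewrite tnth_mktuple (choices_increasing pK).
Qed.

(** * Counting the choices and summing over K *)

Local Open Scope ring_scope.

Lemma card_ord_take n (K : n.-tuple bool) (a : pred bool) m : (m <= n)%N ->
  #|[pred u : 'I_n | a (tnth K u) & (u < m)%N]| = count a (take m K).
Proof.
move=> lemn; rewrite -sum1_count (big_nth false) big_mkord size_takel ?size_tuple //.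
rewrite -sum1_card (big_ord_widen_cond n (fun i => a (nth false (take m K) i)) (fun=> 1%N)) //.
apply: eq_bigl => u; rewrite !inE (tnth_nth false) andbC [RHS]andbC.
by case: ltnP => //= ltum; rewrite nth_take.
Qed.

Lemma card_ord_drop n (K : n.-tuple bool) (a : pred bool) m : (m <= n)%N ->
  #|[pred u : 'I_n | a (tnth K u) & (m <= u)%N]| = count a (drop m K).
Proof.
move=> lemn; apply/eqP; rewrite -(eqn_add2l (count a (take m K))) -count_cat cat_take_drop.
rewrite -(card_ord_take K a lemn) -[X in count a X](take_size K) size_tuple.
rewrite -(card_ord_take K a (leqnn n)).
rewrite -(cardID [pred u : 'I_n | (u < m)%N] [pred u : 'I_n | a (tnth K u) & (u < n)%N]).
by apply/eqP; congr addn; apply: eq_card => u; rewrite !inE ltn_ord andbT // andbC -leqNgt.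
Qed.

Lemma card_option_pred (T : finType) (P : pred (option T)) :
  #|P| = (P None + #|[pred u | P (Some u)]|)%N.
Proof.
have Some_inj : injective (@Some T) by move=> u v [].
rewrite (cardD1 None) -(card_image Some_inj); congr addn.
apply: eq_card => -[u|]; rewrite !inE /=; last by apply/esym/imageP => -[].
by rewrite (mem_image Some_inj).
Qed.

Lemma card_parent_choices n (K : n.-tuple bool) (v : 'I_n) :
  #|parent_choices K v| = mask_weight_at 0 0 K v.
Proof.
rewrite card_option_pred /= /mask_weight_at -tnth_nth !add0n.
case: (tnth K v).
  rewrite add1n -(card_ord_take K id (ltnW (ltn_ord v))); congr S.
  by apply: eq_card => u; rewrite !inE eqb_id; case: (tnth K u).
rewrite add0n -(card_ord_take K negb (ltnW (ltn_ord v))) -(card_ord_drop K id (ltn_ord v)).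
(* The possible parents split into smaller ones outside [K] and larger ones in [K]. *)
rewrite -(cardID [pred u | ~~ tnth K u]); congr addn.
  by apply: eq_card => u; rewrite !inE; case: (tnth K u); rewrite ?andbF ?andbT.
by apply: eq_card => u; rewrite !inE; case: (tnth K u); rewrite ?andbF ?andbT.
Qed.

Lemma num_forests_weight_sum n :
  num_forests_avoiding n one_descent_patterns =
  (\sum_(k < n.+1) weight_sum n k 0 0)%N.
Proof.
pose size_of (K : n.-tuple bool) : 'I_n.+1 := inord (count id K).
rewrite num_forests_sum (partition_big size_of predT) //.
apply: eq_bigr => k _; apply: eq_big => [K|K _] /=.
  have leKn : (count id K < n.+1)%N by rewrite ltnS -[X in (_ <= X)%N](size_tuple K) count_size.
  by rewrite /size_of -val_eqE /= inordK.
rewrite /mask_weight size_tuple; apply: eq_bigr => v _; exact: card_parent_choices.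
Qed.

(** At [j = c = 0] the factor k! cancels in [weight_sumE], leaving n! for every [k]. *)
Lemma num_forests_gcoef n :
  (num_forests_avoiding n one_descent_patterns)%:R =
  n`!%:R * \sum_(k < n.+1) gcoef k (n - k) 0 :> rat.
Proof.
rewrite num_forests_weight_sum natr_sum mulr_sumr; apply: eq_bigr => k _.
have lekn : (k <= n)%N by rewrite -ltnS.
have := weight_sumE k (n - k) 0 0.
rewrite (subnKC lekn) add0n fact0 mulr1 => E.
have nz : k`!%:R != 0 :> rat by rewrite Num.Theory.pnatr_eq0 -lt0n fact_gt0.
by apply: (mulIf nz); rewrite E; ring.
Qed.

Theorem theorem6p2 (n : nat) (hn : (1 <= n)%N) :
  (num_forests_avoiding n [:: [:: 3; 2; 1]; [:: 2; 1; 4; 3]; [:: 3; 1; 4; 2]]%N)%:R =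
  (n`!)%:R *
  (1 + \sum_(1 <= l < n.+1) \sum_(l <= k < n.+1 | (l + k <= n)%N)
         (1 / 2%:R ^+ l) * ('C(n - k - 1, l - 1))%:R * ('C(k, l))%:R) :> rat.
Proof.
rewrite num_forests_gcoef; congr (_ * _).
(* The term [k = n], where every vertex is in K, is the leading 1. *)
rewrite big_ord_recr /= subnn gcoef_r0 addrC; congr (1 + _).
rewrite (big_nat_widenl 1 0) //.
rewrite big_mkcond big_mkord.
transitivity (\sum_(l < n.+1) \sum_(k < n.+1)
   if [&& 0 < l, l + k <= n & l <= k]%N then
     (1 / 2%:R ^+ l) * ('C(n - k - 1, l - 1))%:R * ('C(k, l))%:R else 0 : rat); last first.
  apply: eq_bigr => l _ /=; case: ltnP => /= _; last by rewrite big1.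
  by rewrite (big_nat_widenl l 0) // big_mkcond big_mkord.
(* On the right the terms with [k = n] vanish, since [0 < l] and [l + k <= n] conflict. *)
rewrite exchange_big big_ord_recr /= [X in _ + X]big1 ?addr0 => [|l _]; last first.
  by case: ifP => // /and3P[]; lia.
apply: eq_bigr => k _; rewrite /gcoef addn0.
rewrite (big_ord_widen n.+1
    (fun l => (1 / 2%:R ^+ l) * ('C((n - k).-1, n - k - l))%:R * ('C(k, l))%:R));
  last by rewrite ltnS leq_subr.
rewrite big_mkcond; apply: eq_bigr => -[l ltln] _ /=.
have ltkn := ltn_ord k.
(* The term [l = 0] of [gcoef] contains C(n - k - 1, n - k) = 0. *)
case: l ltln => [|l] ltln; first by rewrite subn0 (@bin_small _ (n - k)) ?mulr0 ?mul0r //; lia.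
have [lelk|ltkl] := leqP l.+1 k; last first.
  by rewrite !andbF (@bin_small k) // mulr0 if_same.
rewrite andbT ltnS ltn_subRL [(k + l)%N]addnC addSn /=.
(* By symmetry of binomial coefficients, C(n - k - 1, n - k - l) = C(n - k - 1, l - 1), here with
   [l.+1] for l. *)
case: ltnP => // lt_lk_n; rewrite !subn1 -[in RHS](@bin_sub _ l); last lia.
by congr (_ * _%:R * _); congr 'C(_, _); lia.
Qed.
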